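(* The fully discrete moving mesh DG scheme (third-order TVD Runge-Kutta in pseudo-time) described in the context conserves the mass. That is, for each step from $\varsigma^\nu$ to $\varsigma^{\nu+1}$, \[ \sum_{K^{\nu+1}\in\mathcal{T}_h(\varsigma^{\nu+1})}\int_{K^{\nu+1}}u^{\nu+1}\,d\bm{x}=\sum_{K^{\nu}\in\mathcal{T}_h(\varsigma^{\nu})}\int_{K^{\nu}}u^{\nu}\,d\bm{x}. \]
   Context: Moving mesh. $\mathcal{D}\subset\mathbb{R}^d$ ($d=1,2$) is a bounded polygonal domain. $\mathcal{T}_h^{old}$, $\mathcal{T}_h^{new}$ are simplicial meshes of $\mathcal{D}$ with the same connectivity and vertices $\bm{x}_i^{old}$, $\bm{x}_i^{new}$, $i=1,\dots,N_v$. For $\varsigma\in[0,1]$, $\mathcal{T}_h(\varsigma)$ is the mesh with the same connectivity and vertices $\bm{x}_i(\varsigma)=(1-\varsigma)\bm{x}_i^{old}+\varsigma\bm{x}_i^{new}$; it is assumed to be a nonsingular mesh of $\mathcal{D}$ for all $\varsigma$. The mesh velocity is $\dot{\bm{X}}(\bm{x},\varsigma)=\sum_i(\bm{x}_i^{new}-\bm{x}_i^{old})\phi_i(\bm{x},\varsigma)$, with $\phi_i(\cdot,\varsigma)$ the continuous piecewise linear hat function of vertex $i$ on $\mathcal{T}_h(\varsigma)$. The boundary of the domain does not move: $\dot{\bm{X}}\cdot\bm{n}=0$ on $\partial\mathcal{D}$. DG space. $V_h^r(\varsigma)=\{v\in L^2(\mathcal{D}): v|_K\in P^r(K)\ \forall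 K\in\mathcal{T}_h(\varsigma)\}$, $r\ge1$, where $P^r(K)$ is the space of polynomials of degree at most $r$. $\widehat K$ is the reference simplex and $F_K:\widehat K\to K$ the affine map. Spatial operator. For an edge (facet) $e\subset\partial K$ with outward unit normal $\bm{n}^e_K$, let $u_K^{in}$ be the trace on $e$ of $u$ from $K$ and $u_K^{out}$ the trace from the neighbor $K'$ across $e$. The numerical flux is \[F_e(u_K^{in},u_K^{out})=\tfrac12\Big(-(u_K^{in}+u_K^{out})\,\dot{\bm{X}}\cdot\bm{n}^e_K-\alpha_e(u_K^{out}-u_K^{in})\Big),\qquad \alpha_e=\max(|\dot{\bm{X}}\cdot\bm{n}_K^e|,|\dot{\bm{X}}\cdot\bm{n}_{K'}^e|),\] with $F_e=0$ on edges of $\partial\mathcal{D}$. Set \[\mathcal{A}(u,v)|_K=\sum_{e\subset\partial K}\int_e vF_e(u_K^{in},u_K^{out})\,ds+\int_K(u\dot{\bm{X}})\cdot\nabla v\,d\bm{x}.\] Fully discrete scheme. Let $0=\varsigma^0<\varsigma^1<\dots<\varsigma^{N_\varsigma}=1$, $\Delta\varsigma^\nu=\varsigma^{\nu+1}-\varsigma^\nu$. $K^\nu$, $K^{\nu,(1)}$, $K^{\nu,(2)}$, $K^{\nu+1}$ denote the same mesh element at pseudo-times $\varsigma^\nu$, $\varsigma^{\nu+1}$, $\varsigma^{\nu}+\frac12\Delta\varsigma^\nu$, $\varsigma^{\nu+1}$ respectively; $u^\nu,u^{(1)},u^{(2)},u^{\nu+1}$ lie in the DG spaces at the corresponding times;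 for each $\hat v\in P^r(\widehat K)$ the test functions are $v^\nu=\hat v\circ F_{K^\nu}^{-1}$, $v^{\nu,(1)}=\hat v\circ F_{K^{\nu,(1)}}^{-1}$, etc. For every element and every $\hat v\in P^r(\widehat K)$, \[ \begin{cases} \int_{K^{\nu,(1)}}u^{(1)}v^{\nu,(1)}d\bm{x}=\int_{K^{\nu}}u^{\nu}v^{\nu}d\bm{x}-\Delta\varsigma^\nu\mathcal{A}(u^\nu,v^\nu)|_{K^\nu},\\ \int_{K^{\nu,(2)}}u^{(2)}v^{\nu,(2)}d\bm{x}=\frac34\int_{K^{\nu}}u^{\nu}v^{\nu}d\bm{x}+\frac14\Big(\int_{K^{\nu,(1)}}u^{(1)}v^{\nu,(1)}d\bm{x}-\Delta\varsigma^\nu\mathcal{A}(u^{(1)},v^{\nu,(1)})|_{K^{\nu,(1)}}\Big),\\ \int_{K^{\nu+1}}u^{\nu+1}v^{\nu+1}d\bm{x}=\frac13\int_{K^{\nu}}u^{\nu}v^{\nu}d\bm{x}+\frac23\Big(\int_{K^{\nu,(2)}}u^{(2)}v^{\nu,(2)}d\bm{x}-\Delta\varsigma^\nu\mathcal{A}(u^{(2)},v^{\nu,(2)})|_{K^{\nu,(2)}}\Big). \end{cases} \] *)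

(* Defs.v *)
From HB Require Import structures.
From mathcomp Require Import all_boot all_order all_algebra.
From mathcomp Require Import -(notations) mpoly.
From mathcomp Require Import all_classical all_reals all_analysis.

Set Implicit Arguments.
Unset Strict Implicit.
Unset Printing Implicit Defensive.

Import Order.TTheory GRing.Theory Num.Theory.
Import numFieldNormedType.Exports.

Local Open Scope classical_set_scope.
Local Open Scope ring_scope.

(** * Lebesgue measure on R^n

    Built on [n.-tuple R] (product sigma-algebra) as the n-fold product of the
    one-dimensional Lebesgue measure; R^0 carries the unit mass at its only
    point. *)

Definition tcons (R : realType) (n : nat)
    (z : measurableTypeR R * n.-tuple (measurableTypeR R)) :
    n.+1.-tuple (measurableTypeR R) :=
  [tuple of z.1 :: z.2].

Lemma measurable_tcons (R : realType) (n : nat) :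
  measurable_fun [set: measurableTypeR R * n.-tuple (measurableTypeR R)]
    (@tcons R n).
Proof. exact: measurable_cons. Qed.

Definition leb_succ (R : realType) (n : nat)
    (mu : {sigma_finite_measure set (n.-tuple (measurableTypeR R)) -> \bar R}) :
    set (n.+1.-tuple (measurableTypeR R)) -> \bar R :=
  pushforward (lebesgue_measure \x mu)%E (@tcons R n).

Section leb_succ_measure.
Context (R : realType) (n : nat).
Context
  (mu : {sigma_finite_measure set (n.-tuple (measurableTypeR R)) -> \bar R}).

Let leb_succ0 : leb_succ mu set0 = 0%E.
Proof. by rewrite /leb_succ /pushforward preimage_set0 measure0. Qed.

Let leb_succ_ge0 A : (0 <= leb_succ mu A)%E.
Proof. by rewrite /leb_succ /pushforward measure_ge0. Qed.

Let leb_succ_sigma_additive : semi_sigma_additive (leb_succ mu).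
Proof.
move=> F mF tF mUF; rewrite /leb_succ /pushforward preimage_bigcup.
have mF' i : measurable (@tcons R n @^-1` F i).
  by rewrite -[X in measurable X]setTI; exact: (@measurable_tcons R n).
apply: measure_semi_sigma_additive => //.
- apply/trivIsetP => /= i j _ _ ij; rewrite -preimage_setI.
  by move/trivIsetP : tF => /(_ _ _ _ _ ij) ->//; rewrite preimage_set0.
- exact: bigcup_measurable.
Qed.

HB.instance Definition _ := isMeasure.Build _ _ _ (leb_succ mu)
  leb_succ0 leb_succ_ge0 leb_succ_sigma_additive.

Let leb_succ_sigma_finite : sigma_finite setT (leb_succ mu).
Proof.
have /sigma_finiteP[F [TF ndF Foo]] := sigma_finiteT (@lebesgue_measure R).
have /sigma_finiteP[G [TG ndG Goo]] := sigma_finiteT mu.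
pose hd (t : n.+1.-tuple (measurableTypeR R)) : measurableTypeR R :=
  tnth t ord0.
pose tl (t : n.+1.-tuple (measurableTypeR R)) :
  n.-tuple (measurableTypeR R) := [tuple of behead t].
have mhd : measurable_fun setT hd by exact: measurable_tnth.
have mtl : measurable_fun setT tl by exact: measurable_behead.
exists (fun k => hd @^-1` F k `&` tl @^-1` G k).
  apply/esym; rewrite -subTset => t _.
  have [i _ Fi] : (\bigcup_i F i) (hd t) by rewrite -TF.
  have [j _ Gj] : (\bigcup_i G i) (tl t) by rewrite -TG.
  exists (maxn i j) => //; split.
    have /subsetPset := ndF _ _ (leq_maxl i j); exact.
  have /subsetPset := ndG _ _ (leq_maxr i j); exact.
move=> k; have [mF Fk] := Foo k; have [mG Gk] := Goo k; split.
  apply: measurableI.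
    by rewrite -[X in measurable X]setTI; exact: mhd.
  by rewrite -[X in measurable X]setTI; exact: mtl.
rewrite /leb_succ /pushforward.
rewrite (_ : _ @^-1` _ = F k `*` G k).
  by rewrite product_measure1E// lte_mul_pinfty// ge0_fin_numE.
apply/seteqP; split => -[a t] /=; rewrite /hd /tl /=.
  by move=> [Fa]; rewrite (_ : [tuple of _] = t)//; exact/val_inj.
move=> [/= Fa Gt]; split => //.
by rewrite (_ : [tuple of _] = t)//; exact/val_inj.
Qed.

HB.instance Definition _ := Measure_isSigmaFinite.Build _ _ _ (leb_succ mu)
  leb_succ_sigma_finite.

End leb_succ_measure.

Fixpoint leb (R : realType) (n : nat) :
    {sigma_finite_measure set (n.-tuple (measurableTypeR R)) -> \bar R} :=
  match n with
  | 0 => @dirac _ (0.-tuple (measurableTypeR R)) [tuple] R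
  | m.+1 => leb_succ (leb R m)
  end.

Definition row_of_tuple (R : realType) (n : nat)
    (t : n.-tuple (measurableTypeR R)) : 'rV[R]_n := \row_i tnth t i.

Definition integralRn (R : realType) (n : nat) (A : set 'rV[R]_n)
    (f : 'rV[R]_n -> R) : R :=
  (\int[leb R n]_(t in @row_of_tuple R n @^-1` A) f (row_of_tuple t))%R.

Definition L2 (R : realType) (n : nat) (A : set 'rV[R]_n) (f : 'rV[R]_n -> R) :
    Prop :=
  (f \_ A) \o @row_of_tuple R n \in Lfun (leb R n) 2%:E.

Definition dot (R : realType) (d : nat) (a b : 'rV[R]_d) : R :=
  \sum_(i < d) a 0 i * b 0 i.

Definition grad (R : realType) (d : nat) (v : 'rV[R]_d -> R) (y : 'rV[R]_d) :
    'rV[R]_d := \row_i 'D_('e_i) v y.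

(** Polynomial functions of total degree at most [r] ([msize] is the total
    degree plus one). *)
Definition polyfun (R : realType) (d r : nat) (f : 'rV[R]_d -> R) : Prop :=
  exists2 p : mpoly.mpoly d R,
    (mpoly.msize p <= r.+1)%N & forall y, f y = mpoly.meval (y 0) p.

(** * Simplices

    A simplex is given by a set [s] of vertex indices and the vertex positions
    [x]; the closed simplex is the convex hull (empty if [s] is empty). *)

Definition simplex (R : realType) (d : nat) (I : finType) (x : I -> 'rV[R]_d)
    (s : {set I}) : set 'rV[R]_d :=
  [set y | exists l : I -> R, [/\ (forall i, 0 <= l i),
     \sum_(i in s) l i = 1 & y = \sum_(i in s) l i *: x i]].

Definition ref_simplex (R : realType) (k : nat) : set 'rV[R]_k :=
  [set t | (forall i, 0 <= t 0 i) /\ \sum_(i < k) t 0 i <= 1].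

(** The vertices of [s] in increasing order of index: the local numbering
    depends on the connectivity only, hence is the same on all moved meshes. *)
Definition vertices (R : realType) (d Nv : nat) (x : 'I_Nv -> 'rV[R]_d)
    (s : {set 'I_Nv}) : seq 'rV[R]_d := [seq x i | i <- enum s].

(** Below, [k] is the dimension of the simplex, i.e. [#|s| = k.+1]. *)
Definition edge_mx (R : realType) (d Nv k : nat) (x : 'I_Nv -> 'rV[R]_d)
    (s : {set 'I_Nv}) : 'M[R]_(k, d) :=
  \matrix_(i < k) ((vertices x s)`_i.+1 - (vertices x s)`_0).

Definition affmap (R : realType) (d Nv k : nat) (x : 'I_Nv -> 'rV[R]_d)
    (s : {set 'I_Nv}) (t : 'rV[R]_k) : 'rV[R]_d :=
  (vertices x s)`_0 + t *m edge_mx k x s.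

Definition affmap_inv (R : realType) (d Nv : nat) (x : 'I_Nv -> 'rV[R]_d)
    (K : {set 'I_Nv}) (y : 'rV[R]_d) : 'rV[R]_d :=
  (y - (vertices x K)`_0) *m invmx (edge_mx d x K).

(** Integral of [g] over a (d-1)-dimensional simplex with respect to the surface
    measure, through its affine parametrization: the Gram factor is the length
    of the segment for d = 2, and for d = 1 the integral is the value of [g] at
    the point. *)
Definition facet_integral (R : realType) (d Nv : nat) (x : 'I_Nv -> 'rV[R]_d)
    (e : {set 'I_Nv}) (g : 'rV[R]_d -> R) : R :=
  let J := edge_mx d.-1 x e in
  integralRn (@ref_simplex R d.-1)
    (fun t => g (affmap x e t) * Num.sqrt (\det (J *m J^T))).

Definition facet_of (d Nv : nat) (K e : {set 'I_Nv}) : bool :=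
  (e \subset K) && (#|e| == d).

(** * Domains and meshes *)

Definition boundary (R : realType) (d : nat) (D : set 'rV[R]_d) :
    set 'rV[R]_d := closure D `\` interior D.

(** The boundary is a finite union of segments (d = 2) or points (d = 1). *)
Definition polygonal_domain (R : realType) (d : nat) (D : set 'rV[R]_d) : Prop :=
  [/\ D !=set0, open D, connected D, bounded_set D &
      exists (m : nat) (p : 'I_m -> 'I_d -> 'rV[R]_d),
        boundary D = \bigcup_j simplex (p j) [set: 'I_d]%SET].

(** Nonsingular conforming simplicial mesh of [D] with connectivity [T] and
    vertices [x]. *)
Definition is_mesh (R : realType) (d Nv : nat) (D : set 'rV[R]_d)
    (T : {set {set 'I_Nv}}) (x : 'I_Nv -> 'rV[R]_d) : Prop :=
  [/\ forall K, K \in T -> #|K| = d.+1,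
      finset.cover T = [set: 'I_Nv]%SET,
      forall K, K \in T -> edge_mx d x K \in unitmx,
      closure D = \bigcup_(K in [set` T]) simplex x K &
      forall K K', K \in T -> K' \in T ->
        simplex x K `&` simplex x K' = simplex x (K :&: K')%SET].

Definition moved_vertex (R : realType) (d Nv : nat)
    (xold xnew : 'I_Nv -> 'rV[R]_d) (s : R) (i : 'I_Nv) : 'rV[R]_d :=
  (1 - s) *: xold i + s *: xnew i.

Definition is_hat (R : realType) (d Nv : nat) (D : set 'rV[R]_d)
    (T : {set {set 'I_Nv}}) (x : 'I_Nv -> 'rV[R]_d) (i : 'I_Nv)
    (f : 'rV[R]_d -> R) : Prop :=
  [/\ {within closure D, continuous f},
      forall K, K \in T -> exists (a : 'rV[R]_d) (b : R),
        forall y, simplex x K y -> f y = dot a y + b &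
      forall j, f (x j) = (j == i)%:R].

Definition mesh_velocity (R : realType) (d Nv : nat)
    (xold xnew : 'I_Nv -> 'rV[R]_d) (phi : R -> 'I_Nv -> 'rV[R]_d -> R)
    (s : R) (y : 'rV[R]_d) : 'rV[R]_d :=
  \sum_(i < Nv) phi s i y *: (xnew i - xold i).

Definition is_outward_normal (R : realType) (d Nv : nat)
    (x : 'I_Nv -> 'rV[R]_d) (K e : {set 'I_Nv}) (n : 'rV[R]_d) : Prop :=
  [/\ dot n n = 1,
      forall a b, a \in e -> b \in e -> dot n (x a - x b) = 0 &
      forall a b, a \in K :\: e -> b \in e -> dot n (x a - x b) < 0].

Definition outward_normal (R : realType) (d Nv : nat) (x : 'I_Nv -> 'rV[R]_d)
    (K e : {set 'I_Nv}) : 'rV[R]_d :=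
  xget 0 [set n | is_outward_normal x K e n].

(** The boundary does not move: on every facet lying on the boundary, the
    velocity [w] has zero normal component. *)
Definition no_boundary_motion (R : realType) (d Nv : nat) (D : set 'rV[R]_d)
    (T : {set {set 'I_Nv}}) (x : 'I_Nv -> 'rV[R]_d)
    (w : 'rV[R]_d -> 'rV[R]_d) : Prop :=
  forall K e, K \in T -> facet_of d K e -> simplex x e `<=` boundary D ->
    forall y, simplex x e y -> dot (w y) (outward_normal x K e) = 0.

(** * DG space and spatial operator *)

(** An element of the DG space is represented by a function which is a
    polynomial on the interior of every element; its values on the (null) union
    of the facets are irrelevant, see [facet_trace]. *)
Definition in_dg (R : realType) (d Nv : nat) (D : set 'rV[R]_d)
    (T : {set {set 'I_Nv}}) (x : 'I_Nv -> 'rV[R]_d) (r : nat)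
    (u : 'rV[R]_d -> R) : Prop :=
  L2 D u /\
  forall K, K \in T -> exists2 p, polyfun r p &
    forall y, (simplex x K)° y -> u y = p y.

Definition facet_trace (R : realType) (d Nv : nat) (x : 'I_Nv -> 'rV[R]_d)
    (K : {set 'I_Nv}) (u : 'rV[R]_d -> R) (y : 'rV[R]_d) : R :=
  lim (u z @[z --> within (simplex x K)° (nbhs y)]).

(** The element across the facet [e] of [K]; the default value [K] is used only
    if there is none. *)
Definition neighbor (Nv : nat) (T : {set {set 'I_Nv}}) (K e : {set 'I_Nv}) :
    {set 'I_Nv} :=
  odflt K [pick K' in T | (K' != K) && (e \subset K')].

Definition num_flux (R : realType) (d Nv : nat) (D : set 'rV[R]_d)
    (T : {set {set 'I_Nv}}) (x : 'I_Nv -> 'rV[R]_d)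
    (w : 'rV[R]_d -> 'rV[R]_d) (K e : {set 'I_Nv}) (u : 'rV[R]_d -> R)
    (y : 'rV[R]_d) : R :=
  if `[< simplex x e `<=` boundary D >] then 0 else
  let K' := neighbor T K e in
  let uin := facet_trace x K u y in
  let uout := facet_trace x K' u y in
  let wn := dot (w y) (outward_normal x K e) in
  let wn' := dot (w y) (outward_normal x K' e) in
  let alpha := Num.max `|wn| `|wn'| in
  2^-1 * (- (uin + uout) * wn - alpha * (uout - uin)).

Definition dg_op (R : realType) (d Nv : nat) (D : set 'rV[R]_d)
    (T : {set {set 'I_Nv}}) (x : 'I_Nv -> 'rV[R]_d)
    (w : 'rV[R]_d -> 'rV[R]_d) (u v : 'rV[R]_d -> R) (K : {set 'I_Nv}) : R :=
  \sum_(e : {set 'I_Nv} | facet_of d K e)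
     facet_integral x e (fun y => v y * num_flux D T x w K e u y)
  + integralRn (simplex x K) (fun y => dot (u y *: w y) (grad v y)).

(** * Fully discrete scheme *)

(** One step of the third-order TVD Runge-Kutta scheme from [s0] to [s1], with
    stages [u1] (at [s1]) and [u2] (at the midpoint). [X s] and [w s] are the
    vertices and the mesh velocity at pseudo-time [s]. *)
Definition tvd_rk3_step (R : realType) (d Nv : nat) (D : set 'rV[R]_d)
    (T : {set {set 'I_Nv}}) (X : R -> 'I_Nv -> 'rV[R]_d)
    (w : R -> 'rV[R]_d -> 'rV[R]_d) (r : nat) (s0 s1 : R)
    (u0 u1 u2 u3 : 'rV[R]_d -> R) : Prop :=
  let ds := s1 - s0 in
  let sh := s0 + 2^-1 * ds in
  let M s (K : {set 'I_Nv}) u (vh : 'rV[R]_d -> R) :=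
    integralRn (simplex (X s) K) (fun y => u y * vh (affmap_inv (X s) K y)) in
  let A s (K : {set 'I_Nv}) u (vh : 'rV[R]_d -> R) :=
    dg_op D T (X s) (w s) u (fun y => vh (affmap_inv (X s) K y)) K in
  forall K, K \in T -> forall vh : 'rV[R]_d -> R, polyfun r vh ->
  [/\ M s1 K u1 vh = M s0 K u0 vh - ds * A s0 K u0 vh,
      M sh K u2 vh = 3 / 4 * M s0 K u0 vh
                     + 1 / 4 * (M s1 K u1 vh - ds * A s1 K u1 vh) &
      M s1 K u3 vh = 1 / 3 * M s0 K u0 vh
                     + 2 / 3 * (M sh K u2 vh - ds * A sh K u2 vh)].

(* Main.v *)
(** Testing the scheme with the constant 1 kills the volume term of the spatial
    operator, so everything reduces to the cancellation of the numerical fluxes,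
    facet by facet. A facet of only one element lies on the boundary: near a
    point of its relative interior no other element is present, so the points
    just across it are outside the closure of the domain. Otherwise exactly two
    elements share the facet: the vertices opposite to it in two distinct
    elements lie strictly on opposite sides (else the elements would overlap),
    which leaves room for two only. Their outward normals are then opposite and
    the flux changes sign when the two elements are exchanged. *)

Require Import Defs.
From HB Require Import structures.
From mathcomp Require Import all_boot all_order all_algebra.
From mathcomp Require Import ring lra.
From mathcomp Require Import -(notations) mpoly.
From mathcomp Require Import all_classical all_reals all_analysis.

Set Implicit Arguments.
Unset Strict Implicit.
Unset Printing Implicit Defensive.

Import Order.TTheory GRing.Theory Num.Theory.
Import numFieldNormedType.Exports.

Local Open Scope classical_set_scope.
Local Open Scope ring_scope.

(** * Bilinearity and definiteness of the dot product *)

Lemma dotDr (R : realType) (d : nat) (n a b : 'rV[R]_d) :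
  dot n (a + b) = dot n a + dot n b.
Proof.
by rewrite /dot -big_split; apply: eq_bigr => i _; rewrite mxE mulrDr.
Qed.

Lemma dotZr (R : realType) (d : nat) (n a : 'rV[R]_d) (c : R) :
  dot n (c *: a) = c * dot n a.
Proof.
by rewrite /dot mulr_sumr; apply: eq_bigr => i _; rewrite mxE mulrCA.
Qed.

Lemma dotC (R : realType) (d : nat) (a b : 'rV[R]_d) : dot a b = dot b a.
Proof. by apply: eq_bigr => i _; rewrite mulrC. Qed.

Lemma dotNr (R : realType) (d : nat) (n a : 'rV[R]_d) :
  dot n (- a) = - dot n a.
Proof. by rewrite -scaleN1r dotZr mulN1r. Qed.

Lemma dot0r (R : realType) (d : nat) (n : 'rV[R]_d) : dot n 0 = 0.
Proof. by rewrite -(scale0r 0) dotZr mul0r. Qed.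

Lemma dot_sumr (R : realType) (d : nat) (I : finType) (P : pred I)
    (n : 'rV[R]_d) (F : I -> 'rV[R]_d) :
  dot n (\sum_(i | P i) F i) = \sum_(i | P i) dot n (F i).
Proof.
by apply: (big_morph (dot n)); [exact: dotDr | exact: dot0r].
Qed.

Lemma dot_eq0 (R : realType) (d : nat) (n : 'rV[R]_d) : dot n n = 0 -> n = 0.
Proof.
move=> /eqP; rewrite /dot psumr_eq0 => [|i _]; last by rewrite -expr2 sqr_ge0.
move=> /allP h; apply/rowP => i; apply/eqP; rewrite !mxE.
by have := h i (mem_index_enum i); rewrite /= mulf_eq0 orbb.
Qed.

(** * Barycentric coordinates with respect to a nondegenerate element *)

Section AffineFrame.
Context {R : realType} {d Nv : nat} {x : 'I_Nv -> 'rV[R]_d}.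
Context {K : {set 'I_Nv}} (cK : #|K| = d.+1).

Lemma sum_enum_recl (V : nmodType) (i0 : 'I_Nv) (F : 'I_Nv -> V) :
  \sum_(i in K) F i =
    F (nth i0 (enum K) 0) + \sum_(j < d) F (nth i0 (enum K) j.+1).
Proof.
rewrite -big_enum (big_nth i0) -cardE cK big_mkord.
by rewrite big_ord_recl.
Qed.

Lemma nth_vertices (i0 : 'I_Nv) (j : nat) : (j < d.+1)%N ->
  (vertices x K)`_j = x (nth i0 (enum K) j).
Proof. by move=> jd; rewrite (nth_map i0) // -cardE cK. Qed.

Lemma mul_edge_mx (i0 : 'I_Nv) (t : 'rV[R]_d) :
  t *m edge_mx d x K = \sum_(j < d) t 0 j *:
    (x (nth i0 (enum K) j.+1) - x (nth i0 (enum K) 0)).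
Proof.
rewrite mulmx_sum_row; apply: eq_bigr => j _; congr (_ *: _).
by apply/rowP => k; rewrite !mxE !(nth_vertices i0) // ltnS.
Qed.

Context (uK : edge_mx d x K \in unitmx).

(** The coefficients away from the base vertex form a row vector killed by the invertible [edge_mx],
    so they vanish; the base coefficient is minus their sum. *)
Lemma affine_free (f : 'I_Nv -> R) :
  \sum_(i in K) f i = 0 -> \sum_(i in K) f i *: x i = 0 ->
  forall i, i \in K -> f i = 0.
Proof.
move=> f0 fx0 i iK.
have := f0; rewrite (sum_enum_recl i).
set b := nth i (enum K) 0 => fb.
pose t : 'rV[R]_d := \row_j f (nth i (enum K) j.+1).
have t0 : t = 0.
  apply: (can_inj (mulmxK uK)); rewrite mul0mx (mul_edge_mx i) -/b.
  under eq_bigr do rewrite mxE scalerBr.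
  rewrite sumrB -scaler_suml; move: fx0; rewrite (sum_enum_recl i) -/b.
  move/eqP; rewrite addrC addr_eq0 => /eqP->.
  by rewrite -opprD -scalerDl fb scale0r oppr0.
have tj (j : 'I_d) : f (nth i (enum K) (nat_of_ord j).+1) = 0.
  by move/rowP/(_ j) : t0; rewrite !mxE.
have fb0 : f b = 0 by rewrite -[RHS]fb big1 ?addr0 // => j _; exact: tj.
have iE : i \in enum K by rewrite mem_enum.
rewrite -(nth_index i iE).
have : (index i (enum K) < d.+1)%N by rewrite -cK cardE index_mem.
by case: (index i (enum K)) => [//|j]; rewrite ltnS => jd; exact: (tj (Ordinal jd)).
Qed.

Lemma affine_coord_inj (f g : 'I_Nv -> R) :
  \sum_(i in K) f i = \sum_(i in K) g i ->
  \sum_(i in K) f i *: x i = \sum_(i in K) g i *: x i ->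
  forall i, i \in K -> f i = g i.
Proof.
move=> fg fgx i iK; apply/eqP; rewrite -subr_eq0; apply/eqP.
apply: (affine_free (f := fun i => f i - g i)) => //.
  by rewrite sumrB fg subrr.
by under eq_bigr do rewrite scalerBl; rewrite sumrB fgx subrr.
Qed.

Lemma affine_span (y : 'rV[R]_d) : exists f : 'I_Nv -> R,
  \sum_(i in K) f i = 1 /\ y = \sum_(i in K) f i *: x i.
Proof.
have [i0 i0K] : exists i, i \in K by apply/card_gt0P; rewrite cK.
set b := nth i0 (enum K) 0.
pose t := (y - x b) *m invmx (edge_mx d x K).
have yE : y - x b = t *m edge_mx d x K by rewrite mulmxKV.
(* The default [0] of [insub] is reached only outside [K]; the base vertex takes the remainder that
   makes the sum [1]. *)
pose f i := if index i (enum K) is j.+1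
  then (if insub j is Some j' then t 0 j' else 0) else 1 - \sum_j t 0 j.
have fS (j : 'I_d) : f (nth i0 (enum K) j.+1) = t 0 j.
  by rewrite /f index_uniq ?enum_uniq -?cardE ?cK ?ltnS // valK.
have fb : f b = 1 - \sum_j t 0 j.
  by rewrite /f /b index_uniq ?enum_uniq -?cardE ?cK.
exists f; rewrite !(sum_enum_recl i0) -/b fb; split.
  by rewrite (eq_bigr _ (fun j _ => fS j)) subrK.
under [X in _ + X]eq_bigr => j _ do rewrite fS.
move/(canRL (subrK _)): yE; rewrite (mul_edge_mx i0) -/b => ->.
under [X in X + _]eq_bigr => j _ do rewrite scalerBr.
by rewrite sumrB -scaler_suml scalerBl scale1r addrAC -addrA addrC.
Qed.

Lemma direction_span (v : 'rV[R]_d) : exists g : 'I_Nv -> R,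
  \sum_(i in K) g i = 0 /\ v = \sum_(i in K) g i *: x i.
Proof.
have [f [f1 vE]] := affine_span v; have [h [h1 oE]] := affine_span 0.
exists (fun i => f i - h i); split; first by rewrite sumrB f1 h1 subrr.
by under eq_bigr do rewrite scalerBl; rewrite sumrB -vE -oE subr0.
Qed.

Lemma affine_coord_dot (n v : 'rV[R]_d) (b : 'I_Nv) (f : 'I_Nv -> R) :
  \sum_(i in K) f i = 1 -> v = \sum_(i in K) f i *: x i ->
  dot n (v - x b) = \sum_(i in K) f i * dot n (x i - x b).
Proof.
move=> f1 ->.
under [RHS]eq_bigr do rewrite -dotZr scalerBr.
by rewrite -dot_sumr sumrB -scaler_suml f1 scale1r.
Qed.

End AffineFrame.

(** * Points of a simplex and of its faces *)

Lemma sum_set_if (I : finType) (V : nmodType) (s K : {set I})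
    (F : I -> V) : s \subset K ->
  \sum_(i in K) (if i \in s then F i else 0) = \sum_(i in s) F i.
Proof.
move=> sK; rewrite -big_mkcondr; apply: eq_bigl => i.
by rewrite andb_idl // => /(fintype.subsetP sK).
Qed.

(** Extending the coefficients by zero lets points of a face be compared through uniqueness of
    coordinates in the whole element. *)
Lemma simplex_subset (R : realType) (d : nat) (I : finType)
    (x : I -> 'rV[R]_d) (s K : {set I}) (y : 'rV[R]_d) :
  s \subset K -> simplex x s y ->
  exists l : I -> R, [/\ forall i, 0 <= l i, forall i, i \notin s -> l i = 0,
    \sum_(i in K) l i = 1 & y = \sum_(i in K) l i *: x i].
Proof.
move=> sK [l [l0 l1 yE]].
exists (fun i => if i \in s then l i else 0); split.
- by move=> i; case: ifP.
- by move=> i /negbTE->.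
- by rewrite sum_set_if.
- rewrite yE -(sum_set_if _ sK); apply: eq_bigr => i _.
  by case: ifP; rewrite ?scale0r.
Qed.

Lemma simplex_coord_ge0 (R : realType) (d : nat) (I : finType)
    (x : I -> 'rV[R]_d) (K : {set I}) (f : I -> R) (y : 'rV[R]_d) :
  (forall i, i \in K -> 0 <= f i) -> \sum_(i in K) f i = 1 ->
  y = \sum_(i in K) f i *: x i -> simplex x K y.
Proof.
move=> f0 f1 yE; exists (fun i => if i \in K then f i else 0); split.
- by move=> i; case: ifP => // /f0.
- by rewrite sum_set_if.
- by rewrite yE; apply: eq_bigr => i ->.
Qed.

(** Outside the simplex some barycentric coordinate is negative; along the ray it is affine in [s],
    so it stays negative for a while. *)
Lemma ray_avoids_simplex (R : realType) (d Nv : nat) (x : 'I_Nv -> 'rV[R]_d)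
    (K : {set 'I_Nv}) (p v : 'rV[R]_d) :
  #|K| = d.+1 -> edge_mx d x K \in unitmx -> ~ simplex x K p ->
  exists2 c : R, 0 < c & forall s : R, 0 < s < c -> ~ simplex x K (p + s *: v).
Proof.
move=> cK uK pK.
have [f [f1 pE]] := affine_span cK uK p.
have [g [g0 vE]] := direction_span cK uK v.
have [i iK fi] : exists2 i, i \in K & f i < 0.
  apply: contrapT => nf; apply: pK; apply: simplex_coord_ge0 f1 pE => i iK.
  by rewrite leNgt; apply/negP => fi; apply: nf; exists i.
(* The [+ 1] keeps the denominator positive when [g i] is zero. *)
exists (- f i / (`|g i| + 1)).
  by rewrite divr_gt0 ?oppr_gt0 // ltr_wpDl.
move=> s /andP[s0]; rewrite ltr_pdivlMr ?ltr_wpDl // => sc [l [l0 l1 yE]].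
have : l i = f i + s * g i.
  apply: (affine_coord_inj cK uK (f := l) (g := fun i => f i + s * g i)) => //.
    by rewrite big_split /= -mulr_sumr f1 g0 mulr0 addr0.
  rewrite -yE pE vE scaler_sumr -big_split; apply: eq_bigr => j _.
  by rewrite scalerDl scalerA.
have := l0 i; have : s * g i <= s * `|g i| by rewrite ler_pM2l // ler_norm.
by move=> h1 h2 h3; clear -s0 sc h1 h2 h3; lra.
Qed.


Lemma interior_line (R : realType) (d : nat) (A : set 'rV[R]_d)
    (p v : 'rV[R]_d) : interior A p ->
  exists2 c : R, 0 < c & forall s : R, `|s| < c -> A (p + s *: v).
Proof.
move=> Ap.
have h : (fun s : R => p + s *: v) @ 0 --> p + 0 *: v.
  by apply: cvgD; [exact: cvg_cst | apply: cvgZl; exact: cvg_id].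
rewrite scale0r addr0 in h.
have /nbhs_ballP[c c0 hc] := h _ Ap.
by exists c => // s sc; apply: hc; rewrite /ball /= sub0r normrN.
Qed.

(** * Facets shared by elements of a conforming mesh *)

Section Mesh.
Context {R : realType} {d Nv : nat} {D : set 'rV[R]_d}.
Context {T : {set {set 'I_Nv}}} {x : 'I_Nv -> 'rV[R]_d}.
Hypothesis mesh : is_mesh D T x.

Let cardT K : K \in T -> #|K| = d.+1. Proof. by case: mesh => + *; apply. Qed.
Let unitT K : K \in T -> edge_mx d x K \in unitmx.
Proof. by case: mesh => _ _ + *; apply. Qed.
Let simplexI K K' : K \in T -> K' \in T ->
  simplex x K `&` simplex x K' = simplex x (K :&: K')%SET.
Proof. by case: mesh => _ _ _ _; exact. Qed.

Lemma facet_opposite (K e : {set 'I_Nv}) : K \in T -> facet_of d K e ->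
  exists2 a, a \notin e & K = a |: e.
Proof.
move=> KT /andP[eK /eqP ce].
have /eqP/cards1P[a aE] : #|K :\: e| = 1%N.
  by rewrite cardsD (finset.setIidPr eK) (cardT KT) ce subSnn.
have : a \in K :\: e by rewrite aE set11.
rewrite inE => /andP[ae aK]; exists a => //.
by rewrite -(finset.setID K e) (finset.setIidPr eK) aE finset.setUC.
Qed.

(** A larger intersection would have [d.+1] vertices and coincide with both elements. *)
Lemma facetsI (K K' e : {set 'I_Nv}) : K \in T -> K' \in T -> K != K' ->
  facet_of d K e -> facet_of d K' e -> (K :&: K')%SET = e.
Proof.
move=> KT K'T KK' /andP[eK /eqP ce] /andP[eK' _]; apply/eqP.
rewrite eq_sym eqEcard finset.subsetI eK eK' ce /= leqNgt; apply/negP => lt.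
have /eqP E : (K :&: K')%SET == K.
  by rewrite eqEcard finset.subsetIl (cardT KT).
have /eqP E' : (K :&: K')%SET == K'.
  by rewrite eqEcard finset.subsetIr (cardT K'T).
by move/eqP: KK'; apply; rewrite -E.
Qed.

(* If the coefficient at [a] were nonnegative, the points of the segment from
   the barycenter of [e] towards [x a'] and close to it would belong to both
   elements, hence to [e]. *)
Lemma opposite_coord_lt0 (e : {set 'I_Nv}) (a a' : 'I_Nv) (f : 'I_Nv -> R) :
  (0 < d)%N -> #|e| = d -> a \notin e -> a' \notin e -> a != a' ->
  a |: e \in T -> a' |: e \in T ->
  \sum_(i in a |: e) f i = 1 -> x a' = \sum_(i in a |: e) f i *: x i ->
  f a < 0.
Proof.
move=> d0 ce ae a'e aa' KT K'T f1 fE; rewrite ltNge; apply/negP => fa.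
set K := a |: e in KT f1 fE; set K' := a' |: e in K'T.
have eK : e \subset K by exact: finset.subsetUr.
have eK' : e \subset K' by exact: finset.subsetUr.
have KK' : K != K'.
  apply/eqP => E; have : a \in K' by rewrite -E finset.setU11.
  by rewrite !inE (negbTE ae) (negbTE aa').
have KI : (K :&: K')%SET = e.
  by apply: facetsI; rewrite /facet_of ?eK ?eK' ?ce ?eqxx.
pose S := \sum_(i in K) `|f i|.
have S0 : 0 <= S by exact: sumr_ge0.
have dR : 0 < d%:R :> R by rewrite ltr0n.
have fS i : i \in K -> `|f i| <= S.
  by move=> iK; rewrite /S (bigD1 i) //= lerDl sumr_ge0.
(* This [t] solves [1 - t = t * (d%:R * S)]: on [e] the weight [(1 - t) / d] equals [t * S], which
   offsets even the most negative [t * f i]. *)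
pose t := (1 + d%:R * S)^-1.
have den : 0 < 1 + d%:R * S by rewrite ltr_pwDl // mulr_ge0 // ltW.
have t0 : 0 < t by rewrite invr_gt0.
have tE : t * (1 + d%:R * S) = 1 by rewrite mulVf // gt_eqF.
have t1 : t <= 1 by rewrite invf_le1 // lerDl mulr_ge0 // ltW.
pose m := \sum_(i in e) d%:R^-1 *: x i.
have m1 : \sum_(i in e) d%:R^-1 = 1 :> R.
  by rewrite sumr_const ce -[_ *+ d]mulr_natr mulVf // gt_eqF.
pose y := (1 - t) *: m + t *: x a'.
(* [q] and [q'] are the coordinates of [y] in [K] and in [K']. *)
pose q i := (if i \in e then (1 - t) * d%:R^-1 else 0) + t * f i.
pose q' i := (if i \in e then (1 - t) * d%:R^-1 else 0) + t * (i == a')%:R.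
have yK : simplex x K y.
  apply: (simplex_coord_ge0 (f := q)).
  - move=> i; rewrite /q; case: ifP => [ie _|ie].
      rewrite -(@ler_pM2l _ d%:R) // mulr0 mulrDr mulrCA divff ?gt_eqF // mulr1.
      have : t * (d%:R * - f i) <= t * (d%:R * S).
        rewrite !ler_pM2l //; apply: le_trans (fS i _); last first.
          exact: (fintype.subsetP eK).
        by rewrite -normrN ler_norm.
      by move: tE; move=> *; nra.
    by rewrite !inE ie orbF => /eqP->; rewrite add0r mulr_ge0 // ltW.
  - rewrite big_split /= -mulr_sumr f1 mulr1.
    by rewrite (sum_set_if _ eK) -mulr_sumr m1 mulr1 subrK.
  - rewrite /y fE /m !scaler_sumr -(sum_set_if _ eK) -big_split.
    apply: eq_bigr => i _ /=; rewrite /q [RHS]scalerDl !scalerA.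
    by case: ifP => _; rewrite ?scale0r.
have q'1 : \sum_(i in K') q' i = 1.
  rewrite big_split /= (sum_set_if _ eK') -mulr_sumr m1 mulr1.
  rewrite -mulr_sumr (bigD1 a') ?finset.setU11 //= eqxx.
  rewrite big1 ?addr0 ?mulr1 ?subrK //.
  by move=> i /andP[_ /negbTE->].
have yE' : y = \sum_(i in K') q' i *: x i.
  rewrite /y /m scaler_sumr -(sum_set_if _ eK').
  under [RHS]eq_bigr do rewrite scalerDl.
  rewrite big_split /=; congr (_ + _).
    by apply: eq_bigr => i _; case: ifP => _; rewrite ?scale0r ?scalerA.
  rewrite (bigD1 a') ?finset.setU11 //= eqxx mulr1.
  rewrite big1 ?addr0 // => i /andP[_ /negbTE->].
  by rewrite mulr0 scale0r.
have yK' : simplex x K' y.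
  apply: (simplex_coord_ge0 (f := q')) => // i _; rewrite /q'.
  apply: addr_ge0; last by rewrite mulr_ge0 ?ler0n // ltW.
  by case: ifP => // _; rewrite mulr_ge0 ?invr_ge0 ?ler0n // subr_ge0.
(* Conformity puts [y] in the facet [e], so its coordinate at [a'] in [K'] must vanish; but that
   coordinate is [t], which is positive. *)
have : simplex x e y by rewrite -KI -simplexI //; split.
move=> /(simplex_subset eK')[l [_ l0 l1 yl]].
have := affine_coord_inj (cardT K'T) (unitT K'T)
  (f := l) (g := q') _ _ (finset.setU11 a' e).
rewrite l1 q'1 -yl -yE' => /(_ erefl erefl).
rewrite l0 // /q' (negbTE a'e) eqxx add0r mulr1 => t00.
by move: t0; rewrite -t00 ltxx.
Qed.

(** Three opposite vertices clash in sign: the coordinate at [a] of the third one is a product of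
    two negative numbers, yet it must itself be negative. *)
Lemma at_most_two_elements (e K K' K'' : {set 'I_Nv}) : (0 < d)%N ->
  K \in T -> K' \in T -> K'' \in T ->
  facet_of d K e -> facet_of d K' e -> facet_of d K'' e ->
  K != K' -> K'' != K -> K'' = K'.
Proof.
move=> d0 KT K'T K''T eK eK' eK'' KK' KK''; apply: contrapT => K'K''.
have /andP[_ /eqP ce] := eK.
have [a ae KE] := facet_opposite KT eK.
have [a' a'e K'E] := facet_opposite K'T eK'.
have [a'' a''e K''E] := facet_opposite K''T eK''.
have aa' : a != a' by apply: contraNneq KK' => aa'; rewrite KE K'E aa'.
have aa'' : a != a'' by apply: contraNneq KK'' => aa''; rewrite KE K''E aa''.
have a'a'' : a' != a'' by apply/eqP => E; apply: K'K''; rewrite K'E K''E E.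
have [f [f1 fE]] := affine_span (cardT KT) (unitT KT) (x a').
have [g [g1 gE]] := affine_span (cardT KT) (unitT KT) (x a'').
have [q [q1 qE]] := affine_span (cardT K'T) (unitT K'T) (x a'').
subst K K' K''.
have fa : f a < 0 by apply: (opposite_coord_lt0 (e := e) (a := a) (a' := a')).
have ga : g a < 0 by apply: (opposite_coord_lt0 (e := e) (a := a) (a' := a'')).
have qa : q a' < 0 by apply: (opposite_coord_lt0 (e := e) (a := a') (a' := a'')).
have eK0 : e \subset a |: e by exact: finset.subsetUr.
(* Substitute the expansion of [x a'] over [K] into that of [x a''] over [K'] and read off the
   coefficient at [a]. *)
have gE' : g a = q a' * f a + (if a \in e then q a else 0).
  apply: (affine_coord_inj (cardT KT) (unitT KT) (f := g)
    (g := fun i => q a' * f i + (if i \in e then q i else 0)));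
    last exact: finset.setU11.
    rewrite big_split /= -mulr_sumr f1 (sum_set_if _ eK0) g1 mulr1.
    by rewrite -[LHS]q1 big_setU1.
  rewrite -gE qE big_setU1 //= fE scaler_sumr.
  rewrite -(sum_set_if _ eK0) -big_split.
  apply: eq_bigr => i _; rewrite [RHS]scalerDl scalerA.
  by case: ifP => _ //; rewrite scale0r.
move: gE'; rewrite (negbTE ae) addr0 => gE'.
by have := nmulr_rgt0 (f a) qa; rewrite fa -gE' ltNge (ltW ga).
Qed.

(** If a point [y] of [e] were interior to [D], moving it slightly towards the barycenter of [e]
    would give a point [p] interior to [D] and in no element but [K]. Moving on from [p] away from
    the opposite vertex then leaves every element while staying in [D], although the elements cover
    its closure. *)
Lemma lone_facet_boundary (e K : {set 'I_Nv}) : (0 < d)%N ->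
  K \in T -> facet_of d K e ->
  (forall K', K' \in T -> facet_of d K' e -> K' = K) ->
  simplex x e `<=` boundary D.
Proof.
move=> d0 KT eK lone y ye.
have [_ _ _ clD _] := mesh.
have /andP[sub /eqP ce] := eK.
have [l [l0 le l1 yE]] := simplex_subset sub ye.
have yK : simplex x K y by apply: (simplex_coord_ge0 (f := l)).
split; first by rewrite clD; exists K.
move=> Dy.
have [a ae KE] := facet_opposite KT eK.
have dR : 0 < d%:R :> R by rewrite ltr0n.
(* The barycenter of [e], with its coordinates extended by zero to [K]. *)
pose m := \sum_(i in K) (if i \in e then d%:R^-1 else 0) *: x i.
have m1 : \sum_(i in K) (if i \in e then d%:R^-1 else 0) = 1 :> R.
  by rewrite sum_set_if // sumr_const ce -[_ *+ d]mulr_natr mulVf // gt_eqF.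
have [c c0 hc] := interior_line (m - y) (nbhs_interior Dy).
(* Halving makes [t] strictly smaller than [c]; the cap [1] keeps the combination convex. *)
pose t := Num.min (c / 2) 1.
have t0 : 0 < t by rewrite lt_min ltr01 andbT divr_gt0.
have half_lt (b : R) : 0 < b -> b / 2 < b.
  by move=> b0; rewrite ltr_pdivrMr // mulr_natr mulr2n ltrDl.
have t1 : t <= 1 by rewrite ge_min lexx orbT.
have tc : `|t| < c.
  by rewrite gtr0_norm // gt_min half_lt.
pose p := y + t *: (m - y).
have Dp : interior D p by exact: hc.
pose q i := (1 - t) * l i + t * (if i \in e then d%:R^-1 else 0).
have q1 : \sum_(i in K) q i = 1.
  by rewrite big_split /= -!mulr_sumr l1 m1 !mulr1 subrK.
have pE : p = \sum_(i in K) q i *: x i.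
  rewrite /p yE /m scalerBr addrCA -{1}[X in _ + (X - _)]scale1r -scalerBl addrC.
  rewrite !scaler_sumr -big_split; apply: eq_bigr => i _.
  by rewrite [RHS]scalerDl !scalerA.
have q0 i : i \in e -> 0 < q i.
  move=> ie; rewrite /q ie ltr_wpDl ?mulr_gt0 ?invr_gt0 //.
  by rewrite mulr_ge0 // subr_ge0.
have qa : q a = 0 by rewrite /q (negbTE ae) le // !mulr0 addr0.
have aK : a \in K by rewrite KE finset.setU11.
have pK : simplex x K p.
  apply: (simplex_coord_ge0 (f := q)) => // i.
  by rewrite KE !inE => /predU1P[->|/q0/ltW//]; rewrite qa.
(* If [p] lay in [K'], its coordinates off [K'] would vanish by conformity; as those on [e] are all
   positive, [K'] would contain [e], and [lone] gives [K' = K]. *)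
have pK' K' : K' \in T -> K' != K -> ~ simplex x K' p.
  move=> K'T K'K pK'; move/eqP: K'K; apply; apply: lone => //.
  rewrite /facet_of ce eqxx andbT; apply/fintype.subsetP => i ie; apply/contraT => iK'.
  have : simplex x (K :&: K')%SET p by rewrite -simplexI.
  move=> /(simplex_subset (finset.subsetIl K K'))[h [h0 hI h1 hE]].
  have iK : i \in K by exact: (fintype.subsetP sub).
  have : q i = h i.
    by apply: (affine_coord_inj (cardT KT) (unitT KT)); rewrite ?q1 ?h1 -?pE.
  by rewrite hI ?inE ?(negbTE iK') ?andbF // => qi0; have := q0 i ie; rewrite qi0 ltxx.
pose v := p - x a.
have [c1 c10 hc1] := interior_line v Dp.
pose good (c : R) := fun K' =>
  K' != K -> forall s : R, 0 < s < c -> ~ simplex x K' (p + s *: v).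
(* A bound common to all other elements, by induction along the list [enum T]. *)
have [c2 c20 hc2] : exists2 c2 : R, 0 < c2 & forall K', K' \in T -> good c2 K'.
  suff [c2 c20 hc2] :
      exists2 c2 : R, 0 < c2 & forall K', K' \in enum T -> good c2 K'.
    by exists c2 => // K'; rewrite -mem_enum => /hc2.
  have : {subset enum T <= T} by move=> K'; rewrite mem_enum.
  elim: (enum T) => [_|K' s IH sT]; first by exists 1.
  have [K'' sK''|c2 c20 hc2] := IH; first by apply: sT; rewrite inE sK'' orbT.
  have K'T : K' \in T by apply: sT; rewrite mem_head.
  have [K'K|K'K] := eqVneq K' K.
    exists c2 => // K''; rewrite inE => /predU1P[->|]; last exact: hc2.
    by rewrite K'K /good eqxx.
  have [c3 c30 hc3] :=
    ray_avoids_simplex v (cardT K'T) (unitT K'T) (pK' K' K'T K'K).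
  exists (Num.min c2 c3); first by rewrite lt_min c20.
  move=> K''; rewrite inE => /predU1P[->|K''s] K''K r; rewrite lt_min => /and3P[r0 r2 r3].
    by apply: hc3; rewrite r0.
  by apply: hc2 => //; rewrite r0.
pose s := Num.min c1 c2 / 2.
have m0 : 0 < Num.min c1 c2 by rewrite lt_min c10.
have s0 : 0 < s by rewrite divr_gt0.
have : s < Num.min c1 c2 by exact: half_lt.
rewrite lt_min => /andP[s1 s2].
have : closure D (p + s *: v).
  by apply: subset_closure; apply: hc1; rewrite gtr0_norm.
rewrite clD => -[K' /= K'T pK''].
have [K'K|K'K] := eqVneq K' K; last by apply: (hc2 K' K'T K'K s) => //; rewrite s0.
rewrite K'K in pK''; have [h [h0 h1 hE]] := pK''.
(* Since [p + s *: v] is [(1 + s) *: p - s *: x a] and [q a = 0], its coordinate at [a] is [- s]. *)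
have : h a = (1 + s) * q a - s * (a == a)%:R.
  apply: (affine_coord_inj (cardT KT) (unitT KT) (f := h)
    (g := fun i => (1 + s) * q i - s * (i == a)%:R)) => //.
    rewrite big_split /= sumrN -!mulr_sumr q1 h1 (bigD1 a) //= eqxx.
    rewrite big1 ?addr0 ?mulr1 ?addrK //.
    by move=> i /andP[_ /negbTE->].
  rewrite -hE; under eq_bigr do rewrite scalerBl -!scalerA.
  rewrite sumrB -!scaler_sumr -pE (bigD1 a) //= eqxx scale1r big1 ?addr0.
    by rewrite scalerA -/s /v scalerBr scalerDl scale1r addrA.
  by move=> i /andP[_ /negbTE->]; rewrite scale0r.
rewrite qa eqxx mulr0 mulr1 sub0r => ha.
by have := h0 a; rewrite ha oppr_ge0 leNgt s0.
Qed.
End Mesh.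

(** * Outward normals on the two sides of a facet *)

Section OutwardNormal.
Context {R : realType} {d Nv : nat} {x : 'I_Nv -> 'rV[R]_d}.

(** The vector [p' *: n - p *: n'] is orthogonal to all edges of the element, which span the space,
    so it is zero. Unit length then gives [p' = p] up to sign, and both are negative. *)
Lemma outward_normal_unique (a : 'I_Nv) (e : {set 'I_Nv}) (n n' : 'rV[R]_d) :
  #|a |: e| = d.+1 -> edge_mx d x (a |: e) \in unitmx ->
  a \notin e -> e != finset.set0 ->
  is_outward_normal x (a |: e) e n -> is_outward_normal x (a |: e) e n' ->
  n = n'.
Proof.
move=> cK uK ae /set0Pn[b be] [n1 ne na] [n'1 n'e n'a].
have aK : a \in (a |: e) :\: e by rewrite !inE ae eqxx.
have /= {}na := na a b aK be; have /= {}n'a := n'a a b aK be.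
set p := dot n (x a - x b) in na; set p' := dot n' (x a - x b) in n'a.
have prop : p' *: n = p *: n'.
  apply/eqP; rewrite -subr_eq0; apply/eqP/dot_eq0.
  set z := _ - _.
  have zi i : i \in a |: e -> dot z (x i - x b) = 0.
    rewrite dotC dotDr dotNr !dotZr ![dot (x i - x b) _]dotC.
    rewrite !inE => /predU1P[->|ie]; first by rewrite mulrC subrr.
    by rewrite ne // n'e // !mulr0 subr0.
  have [g [g0 zE]] := direction_span cK uK z.
  rewrite {2}zE dot_sumr.
  rewrite (eq_bigr (fun i => g i * dot z (x b))) => [|i iK].
    by rewrite -mulr_suml g0 mul0r.
  rewrite dotZr; congr (_ * _); apply/eqP; rewrite -subr_eq0 -dotNr -dotDr.
  by rewrite zi.
have : p' ^+ 2 = p ^+ 2.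
  have := congr1 (fun z => dot z z) prop.
  by rewrite /= !dotZr ![dot (_ *: _) _]dotC !dotZr n1 n'1 !mulr1 -!expr2.
move/eqP; rewrite eqf_sqr => /orP[/eqP pp'|/eqP pp'].
  by apply: (scalerI (ltr0_neq0 n'a)); rewrite prop pp'.
by move: n'a; rewrite pp' oppr_lt0 ltNge (ltW na).
Qed.

(** For [b] in [e], [dot n (x a' - x b)] equals [f a * dot n (x a - x b)]; as [f a] is negative, the
    opposite of an outward normal of one element is an outward normal of the other. *)
Lemma outward_normal_eqN (a a' : 'I_Nv) (e : {set 'I_Nv}) (f f' : 'I_Nv -> R) :
  #|a |: e| = d.+1 -> edge_mx d x (a |: e) \in unitmx ->
  #|a' |: e| = d.+1 -> edge_mx d x (a' |: e) \in unitmx ->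
  a \notin e -> a' \notin e -> e != finset.set0 ->
  \sum_(i in a |: e) f i = 1 -> x a' = \sum_(i in a |: e) f i *: x i ->
  f a < 0 ->
  \sum_(i in a' |: e) f' i = 1 -> x a = \sum_(i in a' |: e) f' i *: x i ->
  f' a' < 0 ->
  outward_normal x (a' |: e) e = - outward_normal x (a |: e) e.
Proof.
have key (b b' : 'I_Nv) (g : 'I_Nv -> R) (n : 'rV[R]_d) :
    b \notin e -> b' \notin e ->
    \sum_(i in b |: e) g i = 1 -> x b' = \sum_(i in b |: e) g i *: x i ->
    g b < 0 -> is_outward_normal x (b |: e) e n ->
    is_outward_normal x (b' |: e) e (- n).
  move=> be b'e g1 gE gb [n1 ne nb]; split.
  - by rewrite dotNr dotC dotNr opprK.
  - by move=> i j ie je; rewrite dotC dotNr dotC ne ?oppr0.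
  - move=> i j; rewrite !inE => /andP[ie]; rewrite (negbTE ie) orbF => /eqP-> je.
    rewrite dotC dotNr dotC oppr_lt0 (affine_coord_dot _ _ g1 gE) big_setU1 //=.
    rewrite big1 ?addr0 => [|k ke]; last by rewrite ne ?mulr0.
    by rewrite nmulr_rgt0 // nb // !inE be eqxx.
move=> cK uK cK' uK' ae a'e e0 f1 fE fa f'1 f'E f'a.
(* Either both normals exist, or both are the default [0] of [xget], which is its own opposite. *)
rewrite /outward_normal; case: xgetP => [n' _ n'P|nP'].
  case: xgetP => [n _ nP|nP].
    apply: (outward_normal_unique cK' uK' a'e e0 n'P).
    exact: (key _ _ _ _ ae a'e f1 fE fa nP).
  by case: (nP (- n')); exact: (key _ _ _ _ a'e ae f'1 f'E f'a n'P).
case: xgetP => [n _ nP|nP]; last by rewrite oppr0.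
by case: (nP' (- n)); exact: (key _ _ _ _ ae a'e f1 fE fa nP).
Qed.
End OutwardNormal.

(** * Integrals of opposite and of zero functions *)

(* Holds without any integrability: when the positive and negative parts both
   have infinite integral, both sides are [0] since [fine] sends [-oo] to [0]. *)
Lemma RintegralN_total (dd : measure_display) (S : measurableType dd)
    (R : realType) (mu : {measure set S -> \bar R}) (A : set S) (f : S -> R) :
  (\int[mu]_(t in A) (- f t))%R = - (\int[mu]_(t in A) f t)%R.
Proof.
rewrite /Rintegral.
rewrite (_ : (fun t => (- f t)%:E) = (\- (EFin \o f))%E) //.
rewrite integralE funeposN funenegN [in RHS]integralE.
have : (0 <= \int[mu]_(t in A) (EFin \o f)^\+ t)%E.
  by apply: integral_ge0 => t _; exact: funepos_ge0.
have : (0 <= \int[mu]_(t in A) (EFin \o f)^\- t)%E.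
  by apply: integral_ge0 => t _; exact: funeneg_ge0.
move: (integral _ _ _) (integral _ _ _) => [p| |] [q| |] //= _ _.
- by rewrite opprB.
- by rewrite oppr0.
- by rewrite oppr0.
- by rewrite oppr0.
Qed.

Lemma Rintegral0 (dd : measure_display) (S : measurableType dd)
    (R : realType) (mu : {measure set S -> \bar R}) (A : set S) :
  (\int[mu]_(t in A) (0 : R))%R = 0.
Proof. by rewrite /Rintegral integral0_eq. Qed.

(** * Cancellation of the fluxes over the mesh *)

Section MassConservation.
Context {R : realType} {d Nv : nat} {D : set 'rV[R]_d}.
Context {T : {set {set 'I_Nv}}} {x : 'I_Nv -> 'rV[R]_d}.
Hypotheses (d0 : (0 < d)%N) (mesh : is_mesh D T x).

Lemma facet_integral0 (e : {set 'I_Nv}) :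
  facet_integral x e (fun=> 0) = 0.
Proof.
rewrite /facet_integral /integralRn.
by under eq_Rintegral do rewrite mul0r; rewrite Rintegral0.
Qed.

Lemma facet_integralN (e : {set 'I_Nv}) (g : 'rV[R]_d -> R) :
  facet_integral x e (fun y => - g y) = - facet_integral x e g.
Proof.
rewrite /facet_integral /integralRn -RintegralN_total.
by under eq_Rintegral do rewrite mulNr.
Qed.

(** The choice made by [pick] is forced, since no third element contains the facet. *)
Lemma neighborE (K K' e : {set 'I_Nv}) : K \in T -> K' \in T -> K != K' ->
  facet_of d K e -> facet_of d K' e -> neighbor T K e = K'.
Proof.
move=> KT K'T KK' eK eK'; rewrite /neighbor; case: pickP => [K''|nK] /=.
  move=> /and3P[K''T K''K eK''].
  apply: (at_most_two_elements mesh d0 KT K'T K''T eK eK') => //.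
  by rewrite /facet_of eK''; case/andP: eK.
by have := nK K'; rewrite K'T eq_sym KK' /=; case/andP: eK' => ->.
Qed.

Lemma outward_normal_neighbor (K K' e : {set 'I_Nv}) :
  K \in T -> K' \in T -> K != K' -> facet_of d K e -> facet_of d K' e ->
  outward_normal x K' e = - outward_normal x K e.
Proof.
move=> KT K'T KK' eK eK'.
have [cT _ uT _ _] := mesh.
have /andP[_ /eqP ce] := eK.
have [a ae KE] := facet_opposite mesh KT eK.
have [a' a'e K'E] := facet_opposite mesh K'T eK'.
have aa' : a != a' by apply: contraNneq KK' => aa'; rewrite KE K'E aa'.
subst K K'.
have [f [f1 fE]] := affine_span (cT _ KT) (uT _ KT) (x a').
have [f' [f'1 f'E]] := affine_span (cT _ K'T) (uT _ K'T) (x a).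
apply: (outward_normal_eqN (f := f) (f' := f')) => //; try exact: cT; try exact: uT.
- by rewrite -card_gt0 ce.
- exact: (opposite_coord_lt0 mesh d0 ce ae a'e).
- by apply: (opposite_coord_lt0 mesh d0 ce a'e ae) => //; rewrite eq_sym.
Qed.

(** Exchanging the elements swaps the traces and reverses the normal: the average term flips through
    the normal, the jump term through the traces, and [alpha] is symmetric. *)
Lemma num_flux_antisym (w : 'rV[R]_d -> 'rV[R]_d) (K K' e : {set 'I_Nv})
    (u : 'rV[R]_d -> R) (y : 'rV[R]_d) :
  K \in T -> K' \in T -> K != K' -> facet_of d K e -> facet_of d K' e ->
  num_flux D T x w K' e u y = - num_flux D T x w K e u y.
Proof.
move=> KT K'T KK' eK eK'; rewrite /num_flux; case: ifP => _; first by rewrite oppr0.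
have K'K : K' != K by rewrite eq_sym.
rewrite (neighborE KT K'T KK' eK eK') (neighborE K'T KT K'K eK' eK).
rewrite (outward_normal_neighbor KT K'T KK' eK eK') dotNr normrN maxxx.
by ring.
Qed.

Lemma facet_fluxes_cancel (w : 'rV[R]_d -> 'rV[R]_d) (u : 'rV[R]_d -> R)
    (e : {set 'I_Nv}) :
  \sum_(K in T | facet_of d K e)
    facet_integral x e (num_flux D T x w K e u) = 0.
Proof.
have [eD|eD] := pselect (simplex x e `<=` boundary D).
  apply: big1 => K _; rewrite -[RHS](facet_integral0 e); congr facet_integral.
  by apply/funext => y; rewrite /num_flux asboolT.
(* Here [e] is an arbitrary vertex set, so it may be a facet of no element; the sum is then
   empty. *)
have [K /andP[KT eK]|none] := pickP [pred K in T | facet_of d K e]; last first.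
  by apply: big1 => K KP; have := none K; rewrite /= KP.
have [K' [K'T eK' K'K]] : exists K', [/\ K' \in T, facet_of d K' e & K' != K].
  apply: contrapT => noK'; apply: eD.
  apply: (lone_facet_boundary mesh d0 KT eK) => K' K'T eK'.
  by apply/eqP/contraT => K'K; case: noK'; exists K'.
have KK' : K != K' by rewrite eq_sym.
rewrite (bigD1 K) /= ?KT // (bigD1 K') /= ?K'T ?eK' //.
rewrite [X in _ + (_ + X)]big1 => [|K'' /andP[/andP[/andP[K''T eK''] K''K] K''K']].
  have -> : num_flux D T x w K' e u = (fun y => - num_flux D T x w K e u y).
    by apply/funext => y; exact: num_flux_antisym.
  by rewrite facet_integralN addr0 subrr.
by move: K''K'; rewrite (at_most_two_elements mesh d0 KT K'T K''T eK) ?eqxx.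
Qed.

Lemma sum_dg_op1 (w : 'rV[R]_d -> 'rV[R]_d) (u : 'rV[R]_d -> R) :
  \sum_(K in T) dg_op D T x w u (fun=> 1) K = 0.
Proof.
rewrite big_split /= [X in _ + X]big1 ?addr0 => [|K _]; last first.
  rewrite /integralRn; under eq_Rintegral => t _.
    rewrite (_ : grad _ _ = 0) ?dot0r; first over.
    by apply/rowP => i; rewrite !mxE derive_cst.
  by rewrite Rintegral0.
(* Sum facet by facet instead of element by element. *)
rewrite (exchange_big_dep predT) //=; apply: big1 => e _.
rewrite -[RHS](facet_fluxes_cancel w u e); apply: eq_bigr => K _.
by congr facet_integral; apply/funext => y; rewrite mul1r.
Qed.

End MassConservation.

(** * Mass balance of the Runge-Kutta stages *)

Lemma polyfun1 (R : realType) (d r : nat) : @polyfun R d r (fun=> 1).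
Proof.
by exists 1; [rewrite mpoly.msize1 | move=> y; rewrite mpoly.meval1].
Qed.

Theorem lemma2p3 (R : realType) (d : nat) (hd : d = 1%N \/ d = 2%N)
  (D : set 'rV[R]_d) (hD : polygonal_domain D)
  (Nv : nat) (T : {set {set 'I_Nv}}) (xold xnew : 'I_Nv -> 'rV[R]_d)
  (hmesh : forall s : R, 0 <= s <= 1 -> is_mesh D T (moved_vertex xold xnew s))
  (phi : R -> 'I_Nv -> 'rV[R]_d -> R)
  (hphi : forall (s : R) (i : 'I_Nv), 0 <= s <= 1 ->
     is_hat D T (moved_vertex xold xnew s) i (phi s i))
  (hbdry : forall s : R, 0 <= s <= 1 ->
     no_boundary_motion D T (moved_vertex xold xnew s)
       (mesh_velocity xold xnew phi s))
  (r : nat) (hr : (1 <= r)%N)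
  (N : nat) (sigma : nat -> R) (hsigma0 : sigma 0%N = 0) (hsigmaN : sigma N = 1)
  (hsigma : forall nu : nat, (nu < N)%N -> sigma nu < sigma nu.+1)
  (u u1 u2 : nat -> 'rV[R]_d -> R)
  (hu : forall nu : nat, (nu <= N)%N ->
     in_dg D T (moved_vertex xold xnew (sigma nu)) r (u nu))
  (hu1 : forall nu : nat, (nu < N)%N ->
     in_dg D T (moved_vertex xold xnew (sigma nu.+1)) r (u1 nu))
  (hu2 : forall nu : nat, (nu < N)%N ->
     in_dg D T
       (moved_vertex xold xnew
          (sigma nu + 2^-1 * (sigma nu.+1 - sigma nu))) r (u2 nu))
  (hscheme : forall nu : nat, (nu < N)%N ->
     tvd_rk3_step D T (moved_vertex xold xnew) (mesh_velocity xold xnew phi) r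
       (sigma nu) (sigma nu.+1) (u nu) (u1 nu) (u2 nu) (u nu.+1)) :
  forall nu : nat, (nu < N)%N ->
    \sum_(K in T)
      integralRn (simplex (moved_vertex xold xnew (sigma nu.+1)) K) (u nu.+1)
    = \sum_(K in T)
      integralRn (simplex (moved_vertex xold xnew (sigma nu)) K) (u nu).

Proof.
move=> nu nuN.
have d0 : (0 < d)%N by case: hd => ->.
have sigma_ge0 k : (k <= N)%N -> 0 <= sigma k.
  elim: k => [|k IH] kN; first by rewrite hsigma0.
  by apply: le_trans (ltW (hsigma k kN)); exact/IH/ltnW.
(* Descend from [sigma N = 1], because [sigma] is only known to increase up to [N]. *)
have sigma_le1 k : (k <= N)%N -> sigma (N - k)%N <= 1.
  elim: k => [|k IH] kN; first by rewrite subn0 hsigmaN.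
  apply: le_trans (IH (ltnW kN)).
  by rewrite -(subnSK kN) ltW // hsigma // -subn_gt0 subKn.
have s01 k : (k <= N)%N -> 0 <= sigma k <= 1.
  by move=> kN; rewrite sigma_ge0 // -(subKn kN) sigma_le1 // leq_subr.
have /andP[a0 a1] := s01 nu (ltnW nuN).
have /andP[b0 b1] := s01 nu.+1 nuN.
have h01 : 0 <= sigma nu + 2^-1 * (sigma nu.+1 - sigma nu) <= 1.
  by clear -a0 a1 b0 b1; apply/andP; split; lra.
pose mass s v := \sum_(K in T)
  integralRn (simplex (moved_vertex xold xnew s) K) v.
pose op s v := \sum_(K in T) dg_op D T (moved_vertex xold xnew s)
  (mesh_velocity xold xnew phi s) v (fun=> 1) K.
have op0 s v : 0 <= s <= 1 -> op s v = 0.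
  by move=> hs; exact: (sum_dg_op1 d0 (hmesh s hs)).
(* The reference polynomial [1] pulls back to the constant [1] on every moved element, so all stages
   share this test function. *)
have step K : K \in T -> _ := fun KT => hscheme nu nuN K KT _ (polyfun1 R d r).
have M1 (A : set 'rV[R]_d) (v : 'rV[R]_d -> R) :
    integralRn A (fun y => v y * 1) = integralRn A v.
  by congr integralRn; apply/funext => y; rewrite mulr1.
set ds := sigma nu.+1 - sigma nu in h01 step.
set s0 := sigma nu in h01 step *; set s1 := sigma nu.+1 in step *.
set sh := s0 + _ in h01 step.
have E1 : mass s1 (u1 nu) = mass s0 (u nu) - ds * op s0 (u nu).
  rewrite /mass /op mulr_sumr -sumrB; apply: eq_bigr => K /step[+ _ _].
  by rewrite /= !M1.
have E2 : mass sh (u2 nu) = 3 / 4 * mass s0 (u nu)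
    + 1 / 4 * (mass s1 (u1 nu) - ds * op s1 (u1 nu)).
  rewrite /mass /op [ds * _]mulr_sumr -sumrB !mulr_sumr -big_split.
  by apply: eq_bigr => K /step[_ + _]; rewrite /= !M1.
have E3 : mass s1 (u nu.+1) = 1 / 3 * mass s0 (u nu)
    + 2 / 3 * (mass sh (u2 nu) - ds * op sh (u2 nu)).
  rewrite /mass /op [ds * _]mulr_sumr -sumrB !mulr_sumr -big_split.
  by apply: eq_bigr => K /step[_ _]; rewrite /= !M1.
change (mass s1 (u nu.+1) = mass s0 (u nu)).
(* With every [op] zero, each stage averages earlier masses with weights [3/4 + 1/4] or [1/3 + 2/3],
   both summing to one. *)
rewrite E3 E2 E1 !op0 ?s01 // ?(ltnW nuN) //; by field.
Qed.
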